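(* For all $k \ge 1$ and $n \ge 5$, every disconnected isolate-free $n$-vertex forest has more than $f_k(n)$ $k$-MDISs. The forest $2P_2$ (the disjoint union of two copies of the path $P_2$) has $f_2(4)+1$ $2$-MDISs, and it has $f_k(4)$ $k$-MDISs for all $k \ge 3$.
   Context: Graphs are finite and simple; a graph is isolate-free if it has no vertex of degree 0. A set $J \subseteq V(G)$ is a distance-$k$ independent set if any two distinct vertices of $J$ are at distance at least $k+1$ (vertices in different components are at infinite distance); a $k$-MDIS is an inclusion-wise maximal distance-$k$ independent set. The function $f_k$ ($k\ge 1$): $f_k(n) = n$ if $n \le k+1$, and $f_k(n) = n - \left\lfloor \frac{n - (k \bmod 2)}{\lfloor k/2 \rfloor + 1} \right\rfloor + 1$ if $n \ge k+2$. *)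

(* Defs.v *)
From HB Require Import structures.
From mathcomp Require Import all_boot.

Set Implicit Arguments.
Unset Strict Implicit.
Unset Printing Implicit Defensive.

Record sgraph := SGraph {
  vertex :> finType;
  edge : rel vertex;
  edge_sym : symmetric edge;
  edge_irrefl : irreflexive edge
}.

Section SGraphTheory.

Variable G : sgraph.
Implicit Types (x y : G) (J : {set G}) (k d : nat).

Definition degree x : nat := #|[set y | edge x y]|.

Definition isolate_free : bool := [forall x : G, degree x != 0].

Definition connected : bool :=
  [forall x : G, forall y : G, connect (@edge G) x y].

(* [ucycle] also accepts the empty sequence and the traversal [:: x; y] of a  *)
(* single edge in both directions; the cycles of a simple graph are those     *)
(* with at least three vertices.                                              *)
Definition forest : Prop :=
  forall p : seq G, 3 <= size p -> ~ ucycle (@edge G) p.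

Definition walk_of_length d x y : bool :=
  [exists p : d.-tuple G, path (@edge G) x p && (last x p == y)].

Lemma connect_walk x y :
  connect (@edge G) x y -> exists d, walk_of_length d x y.
Proof.
case/connectP=> p ep ->; exists (size p).
by apply/existsP; exists (in_tuple p); rewrite ep eqxx.
Qed.

(* [None] stands for the infinite distance between different components. *)
Definition distance x y : option nat :=
  if @idP (connect (@edge G) x y) is ReflectT cxy
  then Some (ex_minn (connect_walk cxy)) else None.

Definition distance_at_least d x y : bool :=
  if distance x y is Some d' then d <= d' else true.

Definition dist_independent k J : bool :=
  [forall x in J, forall y in J, (x != y) ==> distance_at_least k.+1 x y].

Definition MDIS k J : bool := maxset (dist_independent k) J.

Definition num_MDIS k : nat := #|[set J : {set G} | MDIS k J]|.

End SGraphTheory.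

Section PathGraph.

Variable n : nat.

Definition path_edge : rel 'I_n := fun i j => (i.+1 == j) || (j.+1 == i).

Lemma path_edge_sym : symmetric path_edge.
Proof. by move=> i j; rewrite /path_edge orbC. Qed.

Lemma path_edge_irrefl : irreflexive path_edge.
Proof. by move=> i; rewrite /path_edge orbb gtn_eqF. Qed.

Definition path_graph : sgraph := SGraph path_edge_sym path_edge_irrefl.

End PathGraph.

Section DisjointUnion.

Variables G H : sgraph.

Definition union_edge : rel (G + H) := fun u v =>
  match u, v with
  | inl x, inl y => edge x y
  | inr x, inr y => edge x y
  | _, _ => false
  end.

Lemma union_edge_sym : symmetric union_edge.
Proof. by move=> [x|x] [y|y] //=; rewrite edge_sym. Qed.

Lemma union_edge_irrefl : irreflexive union_edge.
Proof. by move=> [x|x] /=; rewrite edge_irrefl. Qed.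

Definition disjoint_union : sgraph := SGraph union_edge_sym union_edge_irrefl.

End DisjointUnion.

(* No subtraction is truncated here: k %% 2 <= 1 <= n in the second case, and *)
(* the quotient is at most n.                                                 *)
Definition f (k n : nat) : nat :=
  if n <= k + 1 then n else n - (n - k %% 2) %/ (k %/ 2 + 1) + 1.

(* Main.v *)
Require Import Defs.
From mathcomp Require Import all_boot.
From mathcomp Require Import zify.

(** The k-MDISs of G are the maximal independent sets of the k-th power of G,
    in which two vertices are adjacent when a walk of length at most k joins
    them.  Between two unions of components of G this power has no edges, so
    counts multiply ([mis_union]), and a product of two lower bounds beats
    f k n, which is roughly additive in n.

    For k = 1, f 1 n <= 2 while each side contributes at least 2.

    For k >= 2 and n >= k + 2 we have f k n <= n - 1, and it suffices that an
    isolate-free forest on m vertices has at least (m + 2) / 2 k-MDISs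
    ([forest_mis_bound]): if a + b = n with a, b >= 2, then
    (a + 2)(b + 2) / 4 >= n.  That bound rests on one observation about any
    graph ([mis_dominated]): if u and v are adjacent and every neighbour of u
    other than v is a neighbour of v, then deleting v loses at least one maximal
    independent set, whereas deleting an arbitrary vertex never creates one.  In
    an isolate-free forest some leaf p, with neighbour c, is such that either
    another leaf hangs from c, and then the two leaves have the same neighbours
    in the power, or c has at most one neighbour besides p, and then c dominates
    p.  Deleting p in the first case, and p and c in the second, leaves an
    isolate-free forest with the same distances between surviving vertices, so
    that each gain of one k-MDIS costs at most two vertices.

    For k >= 2 and n <= k + 1, f k n = n, and every component is a clique of the
    power, so the number of k-MDISs is the product of the orders of the
    components.  A union of components on m vertices therefore has at least m of
    them ([mis_small]), and a * b > a + b when a, b >= 2 and a + b >= 5.  In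
    2P_2 the components are cliques of the power as soon as k >= 1, which gives
    2 * 2 = 4. *)

Set Implicit Arguments.
Unset Strict Implicit.
Unset Printing Implicit Defensive.

(** * Maximal independent subsets of a vertex set *)

Section MaximalIndependentSets.

Variables (T : finType) (r : rel T).
Implicit Types (A B J K M : {set T}) (u v x y : T).

Definition indep A J : bool :=
  (J \subset A) && [forall x in J, forall y in J, (x != y) ==> ~~ r x y].

Lemma indepP A J :
  reflect (J \subset A /\ {in J &, forall x y, x != y -> ~~ r x y}) (indep A J).
Proof.
apply: (iffP andP) => -[sJA indJ]; split=> //.
  move=> x y xJ yJ; move/forall_inP/(_ x xJ)/forall_inP/(_ y yJ): indJ.
  by move/implyP.
by do 2![apply/forall_inP=> ? ?]; apply/implyP; apply: indJ.
Qed.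

Definition MIS A : {set {set T}} := [set J | maxset (indep A) J].

Lemma misP A J :
  reflect (indep A J /\ forall K, indep A K -> J \subset K -> K = J)
          (J \in MIS A).
Proof. by rewrite inE; apply: (iffP maxsetP). Qed.

Lemma indep_extend A J : indep A J -> exists2 M, M \in MIS A & J \subset M.
Proof. by case/maxset_exists=> M maxM sJM; exists M; rewrite ?inE. Qed.

Lemma indep1 A x : x \in A -> indep A [set x].
Proof.
move=> xA; apply/indepP; split; first by rewrite sub1set.
by move=> y z /set1P-> /set1P->; rewrite eqxx.
Qed.

Lemma indep_trace A B J : B \subset A -> indep A J -> indep B (J :&: B).
Proof.
move=> sBA /indepP[_ indJ]; apply/indepP; split; first exact: subsetIr.
by move=> x y /setIP[xJ _] /setIP[yJ _]; apply: indJ.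
Qed.

Lemma mis_gt0 A : 0 < #|MIS A|.
Proof.
have [|M MA _] := @indep_extend A set0; last by apply/card_gt0P; exists M.
by apply/indepP; split=> [|x y]; rewrite ?sub0set ?inE.
Qed.

(** Extending a maximal independent subset J of B to one of A adds nothing inside
    B, so J is recovered as a trace; hence counting is monotone.  The traces of
    maximal sets need not themselves be maximal. *)
Lemma mis_trace A B :
  B \subset A -> MIS B \subset [set M :&: B | M in MIS A].
Proof.
move=> sBA; apply/subsetP=> J /misP[/indepP[sJB indJ] maxJ].
have [|M MA sJM] := @indep_extend A J.
  by apply/indepP; split=> //; apply: subset_trans sBA.
have [indM _] := misP _ _ MA.
apply/imsetP; exists M => //; apply/esym/maxJ; first exact: indep_trace indM.
by rewrite subsetI sJM.
Qed.

Lemma leq_mis A B : B \subset A -> #|MIS B| <= #|MIS A|.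
Proof.
by move/mis_trace/subset_leq_card/leq_trans; apply; apply: leq_imset_card.
Qed.

Lemma mis_clique A :
  A != set0 -> {in A &, forall x y, r x y} -> #|MIS A| = #|A|.
Proof.
case/set0Pn=> x0 x0A clA.
have -> : MIS A = [set [set x] | x in A]; last by rewrite card_imset //; apply: set1_inj.
have small J x : indep A J -> x \in J -> J = [set x].
  case/indepP=> /subsetP sJA indJ xJ; apply/setP=> y; rewrite inE.
  apply/idP/eqP=> [yJ | -> //].
  by apply: contraTeq (clA y x (sJA y yJ) (sJA x xJ)); apply: indJ.
apply/setP=> J; apply/idP/imsetP=> [/misP[indJ maxJ] | [x xA ->]].
  have [J0 | [x xJ]] := set_0Vmem J.
    have := maxJ _ (indep1 x0A); rewrite J0 sub0set => /(_ isT)/setP/(_ x0).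
    by rewrite !inE eqxx.
  by exists x; [case/indepP: indJ => /subsetP/(_ x xJ) | apply: small].
apply/misP; split=> [|K indK]; first exact: indep1.
by rewrite sub1set; apply: small.
Qed.

Hypothesis r_sym : symmetric r.

(** If deleting v lost nothing, then by [mis_trace] every trace on A :\ v would
    be maximal.  But a maximal set M containing v avoids the neighbours of v,
    hence those of u, so M without v could be enlarged by u. *)
Lemma mis_dominated A u v :
  u \in A -> v \in A -> u != v -> r u v ->
  {in A, forall w, w != u -> r u w -> r v w} ->
  #|MIS (A :\ v)| < #|MIS A|.
Proof.
move=> uA vA uv ruv dom; have sDA := subD1set A v.
rewrite ltnNge; apply/negP=> le_mis.
have [M MA] := indep_extend (indep1 vA); rewrite sub1set => vM.
have [/indepP[/subsetP sMA indM] _] := misP _ _ MA.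
have/eqP imMIS : MIS (A :\ v) == [set M :&: (A :\ v) | M in MIS A].
  rewrite eqEcard mis_trace //; apply: leq_trans le_mis.
  exact: leq_imset_card.
have /misP[_ maxM] : M :&: (A :\ v) \in MIS (A :\ v).
  by rewrite imMIS; apply/imsetP; exists M.
have uM : u \notin M by apply/negP=> uM; case/negP: (indM u v uM vM uv).
have far w : w \in M -> w != v -> ~~ r u w.
  move=> wM wv; have wu : w != u by apply: contraNneq uM => <-.
  have:= indM v w vM wM; rewrite eq_sym => /(_ wv); apply: contra.
  exact: dom (sMA w wM) wu.
have /maxM/(_ (subsetUr _ _))/setP/(_ u) : indep (A :\ v) (u |: M :&: (A :\ v)).
  apply/indepP; split.
    by rewrite subUset sub1set subsetIr !inE uv uA.
  move=> x y; rewrite !inE.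
  case/orP=> [/eqP-> | /and3P[xM xv xA]].
    case/orP=> [/eqP-> | /and3P[yM yv yA] _]; first by rewrite eqxx.
    exact: far.
  case/orP=> [/eqP-> _ | /and3P[yM yv yA]]; first by rewrite r_sym far.
  exact: indM.
by rewrite !inE eqxx (negPf uM).
Qed.

Lemma mis_union A B :
  [disjoint A & B] -> {in A & B, forall x y, ~~ r x y} ->
  #|MIS (A :|: B)| = #|MIS A| * #|MIS B|.
Proof.
move=> dAB sep.
have dBA : [disjoint B & A] by rewrite disjoint_sym.
have splitA J K : J \subset A -> K \subset B -> (J :|: K) :&: A = J.
  move=> sJA sKB; rewrite setIUl (setIidPl sJA) [K :&: A]disjoint_setI0 ?setU0 //.
  exact: disjointWl dBA.
have splitB J K : J \subset A -> K \subset B -> (J :|: K) :&: B = K.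
  move=> sJA sKB; rewrite setIUl (setIidPl sKB) [J :&: B]disjoint_setI0 ?set0U //.
  exact: disjointWl dAB.
have join J K : indep A J -> indep B K -> indep (A :|: B) (J :|: K).
  move=> /indepP[sJA indJ] /indepP[sKB indK].
  apply/indepP; split; first exact: setUSS.
  move=> x y /setUP[xJ | xK] /setUP[yJ | yK]; [exact: indJ | | | exact: indK].
    by move=> _; apply: sep; [apply: subsetP xJ | apply: subsetP yK].
  by move=> _; rewrite r_sym; apply: sep; [apply: subsetP yJ | apply: subsetP xK].
have traceU M : M \subset A :|: B -> M = (M :&: A) :|: (M :&: B).
  by move=> sM; rewrite -setIUr (setIidPl sM).
have -> : MIS (A :|: B) = [set p.1 :|: p.2 | p in setX (MIS A) (MIS B)].
  apply/setP=> M; apply/idP/imsetP=> [/misP[indM maxM] | [[J K]]].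
    have [sM _] := indepP _ _ indM.
    have iA := indep_trace (subsetUl A B) indM.
    have iB := indep_trace (subsetUr A B) indM.
    exists (M :&: A, M :&: B); last exact: traceU.
    rewrite inE /=; apply/andP; split; apply/misP; split=> // K iK sK.
      have [sKA _] := indepP _ _ iK.
      rewrite -(maxM _ (join _ _ iK iB)) ?splitA ?subsetIr //.
      by rewrite {1}[M]traceU // setSU.
    have [sKB _] := indepP _ _ iK.
    rewrite -(maxM _ (join _ _ iA iK)) ?splitB ?subsetIr //.
    by rewrite {1}[M]traceU // setUS.
  rewrite inE /= => /andP[/misP[iJ maxJ] /misP[iK maxK]] ->.
  have [[sJA _] [sKB _]] := (indepP _ _ iJ, indepP _ _ iK).
  apply/misP; split=> [|L iL sL]; first exact: join.
  have [sLAB _] := indepP _ _ iL.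
  rewrite (traceU L) //; congr (_ :|: _).
    apply: maxJ (indep_trace (subsetUl A B) iL) _.
    by rewrite -(splitA J K sJA sKB) setSI.
  apply: maxK (indep_trace (subsetUr A B) iL) _.
  by rewrite -(splitB J K sJA sKB) setSI.
rewrite card_in_imset ?cardsX //.
move=> [J K] [J' K'] /setXP[/misP[/indepP[sJ _] _] /misP[/indepP[sK _] _]].
move=> /setXP[/misP[/indepP[sJ' _] _] /misP[/indepP[sK' _] _]] /= eqU.
congr (_, _).
  by rewrite -(splitA J K) // eqU splitA.
by rewrite -(splitB J K) // eqU splitB.
Qed.

End MaximalIndependentSets.

Lemma eq_in_mis (T : finType) (r r' : rel T) (A : {set T}) :
  {in A &, r =2 r'} -> MIS r A = MIS r' A.
Proof.
move=> eq_r; apply/setP=> J; rewrite !inE; apply: maxset_eq => K.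
apply/indepP/indepP=> -[/[dup] /subsetP sJA ? indJ]; split=> // x y xJ yJ.
  by rewrite -eq_r ?sJA //; apply: indJ.
by rewrite eq_r ?sJA //; apply: indJ.
Qed.

(** * Bounded walks inside a vertex set *)

Section Reach.

Variable G : sgraph.
Implicit Types (A B C : {set G}) (x y z q c : G) (m n k : nat).

Fixpoint reach A n x y : bool :=
  if n is m.+1 then
    reach A m x y || [exists z in A, edge x z && reach A m z y]
  else x == y.

Lemma reach_leq A m n x y : m <= n -> reach A m x y -> reach A n x y.
Proof.
by move=> /subnK <-; elim: (n - m) => //= d IH /IH ->.
Qed.

Lemma reachS A n x z y :
  z \in A -> edge x z -> reach A n z y -> reach A n.+1 x y.
Proof.
by move=> zA xz zy /=; apply/orP; right; apply/existsP; exists z; rewrite zA xz.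
Qed.

(** Since walks of length at most n are counted, a walk may idle; between distinct
    vertices it makes a genuine first step. *)
Lemma reach_first A n x y : reach A n x y -> x != y ->
  exists m z, [/\ n = m.+1, z \in A, edge x z & reach A m z y].
Proof.
elim: n => [/eqP-> | n IH /=]; first by rewrite eqxx.
case/orP=> [xy /(IH xy) [m [z [-> zA xz zy]]] | /existsP[z /and3P[zA xz zy]] _].
  by exists m.+1, z; split=> //; apply: reach_leq zy.
by exists n, z.
Qed.

Lemma reach_last A n x z y :
  y \in A -> reach A n x z -> edge z y -> reach A n.+1 x y.
Proof.
move=> yA; elim: n x => [x /eqP<- xy | n IH x].
  exact: (@reachS _ 0 _ _ _ yA xy (eqxx _)).
case/orP=> [xz zy | /existsP[w /and3P[wA xw wz]] zy].
  by apply: (reach_leq (leqnSn _)); apply: IH.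
by apply: (reachS wA xw); apply: IH.
Qed.

Lemma reach_symW A n x y : x \in A -> reach A n x y -> reach A n y x.
Proof.
elim: n x => [x _ /eqP-> //= | n IH x xA].
move=> /= /orP[xy | /existsP[z /and3P[zA xz zy]]]; first by rewrite IH.
by apply: reach_last (IH z zA zy) _; rewrite // edge_sym.
Qed.

Lemma reach_sym A n : {in A &, symmetric (reach A n)}.
Proof. by move=> x y xA yA; apply/idP/idP; apply: reach_symW. Qed.

Lemma reach_setT_sym n : symmetric (reach [set: G] n).
Proof. by move=> x y; apply: reach_sym; rewrite inE. Qed.

Lemma reachW A B n x y : A \subset B -> reach A n x y -> reach B n x y.
Proof.
move/subsetP=> sAB; elim: n x => //= n IH x.
case/orP=> [/IH -> // | /existsP[z /and3P[zA xz zy]]].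
by apply/orP; right; apply/existsP; exists z; rewrite sAB // xz IH.
Qed.

Lemma reach_closed C n x y : closed (@edge G) C ->
  x \in C -> reach setT n x y -> (y \in C) && reach C n x y.
Proof.
move=> clC; elim: n x => [x xC /eqP<- /= | n IH x xC /=]; first by rewrite xC eqxx.
case/orP=> [/(IH x xC)/andP[-> -> //] | /existsP[z /and3P[_ xz]]].
have zC : z \in C by rewrite -(clC x z xz).
case/(IH z zC)/andP=> -> zy; apply/orP; right.
by apply/existsP; exists z; rewrite zC xz.
Qed.

Lemma reach_path p x : path (@edge G) x p -> reach setT (size p) x (last x p).
Proof.
elim: p x => [x _ | y p IH x /andP[xy yp]]; first exact: eqxx.
by apply: reachS xy (IH y yp); rewrite inE.
Qed.

Lemma reach_walk n x y :
  reflect (exists2 m, m <= n & walk_of_length m x y) (reach setT n x y).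
Proof.
apply: (iffP idP) => [|[m le_mn /existsP[p /andP[xp /eqP<-]]]]; last first.
  by apply: reach_leq (reach_path xp); rewrite size_tuple.
elim: n x => [x /eqP-> | n IH x /=].
  by exists 0 => //; apply/existsP; exists [tuple]; rewrite /= eqxx.
case/orP=> [/IH[m mn] | /existsP[z /and3P[_ xz /IH[m mn]]]].
  by exists m => //; apply: leqW.
case/existsP=> p /andP[zp lp]; exists m.+1 => //.
by apply/existsP; exists [tuple of z :: p]; rewrite /= xz zp.
Qed.

Lemma distance_at_leastE k x y :
  distance_at_least k.+1 x y = ~~ reach setT k x y.
Proof.
rewrite /distance_at_least /distance.
case: {-}_ / idP => [cxy | ncxy].
  case: ex_minnP => d wd min_d; rewrite ltnNge; congr (~~ _).
  apply/idP/reach_walk=> [dk | [m mk /min_d/leq_trans]]; first by exists d.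
  exact.
apply/esym/negP=> /reach_walk[m _ /existsP[p /andP[xp /eqP xy]]].
by apply: ncxy; apply/connectP; exists p.
Qed.

Lemma num_MDIS_mis k : num_MDIS G k = #|MIS (reach [set: G] k) setT|.
Proof.
rewrite /num_MDIS; congr #|pred_of_set _|; apply/setP=> J; rewrite !inE.
apply: maxset_eq => K; apply/idP/indepP => [/forall_inP indJ | [_ indJ]].
  split=> [|x y xJ yJ xy]; first exact: subsetT.
  rewrite -distance_at_leastE.
  by move/forall_inP/(_ y yJ)/implyP: (indJ x xJ); apply.
apply/forall_inP=> x xJ; apply/forall_inP=> y yJ; apply/implyP=> xy.
by rewrite distance_at_leastE indJ.
Qed.

(** * Leaves of a forest *)

Definition nbrs A x : {set G} := [set y in A | edge x y].

Lemma nbrsP A x : reflect {in A &, forall y z, edge x y -> edge x z -> y = z}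
  (#|nbrs A x| <= 1).
Proof.
apply: (iffP card_le1_eqP) => [le1 y z yA zA xy xz | le1 y z].
  by apply: le1; rewrite inE ?yA ?zA.
by rewrite !inE => /andP[? ?] /andP[? ?]; apply: le1.
Qed.

Lemma nbrsS A B x : A \subset B -> #|nbrs A x| <= #|nbrs B x|.
Proof. by move=> sAB; rewrite subset_leq_card // /nbrs !setIdE setSI. Qed.

(** A walk entering v must leave it by the edge it came through, so the detour can
    be cut out: deleting a vertex of degree at most 1 preserves distances. *)
Lemma reach_delete A v n : #|nbrs A v| <= 1 ->
  {in A :\ v &, reach (A :\ v) n =2 reach A n}.
Proof.
move/nbrsP=> le1 x y /[dup] xAv /setD1P[xv xA] /setD1P[yv yA]; apply/idP/idP.
  exact: reachW (subD1set A v).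
elim/ltn_ind: n x xv xA xAv => n IH x xv xA xAv xy.
have [-> | neq] := eqVneq x y; first by apply: (@reach_leq _ 0) => /=.
have [m [z [def_n zA xz zy]]] := reach_first xy neq.
have [zv | zv] := eqVneq z v; last first.
  have zAv : z \in A :\ v by rewrite !inE zv.
  by rewrite def_n; apply: (reachS zAv xz); apply: IH; rewrite // def_n.
rewrite zv in xz zy; have vy : v != y by rewrite eq_sym.
have [m' [z' [def_m zA' vz zy']]] := reach_first zy vy.
have zx : z' = x by apply: le1; rewrite // edge_sym.
rewrite zx in zy'; have lt_m : m' < n by rewrite def_n def_m ltnS leqnSn.
exact: reach_leq (ltnW lt_m) (IH m' lt_m x xv xA xAv zy').
Qed.

Definition isolate_free_on A : Prop := {in A, forall x, 0 < #|nbrs A x|}.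

Hypothesis forestG : forest G.

Lemma forest_no_chord x y p :
  path (@edge G) x p -> uniq (x :: p) -> y \in p -> edge x y -> y = head x p.
Proof.
case: p => // z p /=; rewrite in_cons => xp uxp; case/predU1P=> // yp xy.
case/splitPr: yp xp uxp => p1 p2.
rewrite cat_path /= -!cat_rcons => /and3P[xz zp1 /andP[p1y _]] uxp.
case: (forestG (p := x :: z :: rcons p1 y)); first by rewrite /= size_rcons.
apply/andP; split.
  by rewrite /= rcons_path last_rcons xz rcons_path zp1 p1y edge_sym.
by have: uniq ((x :: z :: rcons p1 y) ++ p2) := uxp; rewrite cat_uniq => /and3P[].
Qed.

(** A simple path whose end x has two neighbours in A can be prolonged inside A,
    because in a forest only one neighbour of x lies on the path. *)
Lemma forest_low_degree A : A != set0 -> exists2 x, x \in A & #|nbrs A x| <= 1.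
Proof.
case/set0Pn=> x0 x0A.
suff grow n x p : #|G| - size p <= n -> path (@edge G) x p -> uniq (x :: p) ->
    x \in A -> exists2 x, x \in A & #|nbrs A x| <= 1.
  by apply: (grow #|G| x0 [::]); rewrite ?leq_subr.
elim: n x p => [|n IH] x p le_n xp uxp xA.
  move: le_n; rewrite leqn0 subn_eq0 => le_p.
  by have := max_card (mem (x :: p)); rewrite (card_uniqP uxp) ltnNge le_p.
have [|/nbrsP le1] := boolP (#|nbrs A x| <= 1); first by exists x.
have [/existsP[y /and3P[yA xy yhead]] | none] :=
  boolP [exists y, [&& y \in A, edge x y & y != head x p]].
  apply: (IH y (x :: p)); rewrite /= ?(edge_sym y) ?xy //.
    by rewrite subnS; case: (_ - _) le_n.
  move: (uxp) => /= ->; rewrite andbT inE negb_or; apply/andP; split.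
    by apply: contraTneq xy => ->; rewrite edge_irrefl.
  by apply: contraNN yhead => yp; apply/eqP; apply: forest_no_chord yp xy.
case: le1 => y z yA zA xy xz.
have h w : w \in A -> edge x w -> w = head x p.
  move=> wA xw; apply: contraNeq none => wh.
  by apply/existsP; exists w; rewrite wA xw.
by rewrite (h y) // (h z).
Qed.

(** Delete all vertices of degree at most 1; what remains is a forest, so it has a
    vertex c with at most one remaining neighbour.  The other neighbours of c are
    leaves of A, and there is one since c had degree at least 2.  If nothing
    remains, every component of A is a single edge. *)
Lemma forest_penultimate A : A != set0 -> isolate_free_on A ->
  exists p c, [/\ p \in A, c \in A, edge p c, #|nbrs A p| <= 1 &
    {in A, forall q, q != p -> edge q c -> 1 < #|nbrs A q|} ->
    #|nbrs (A :\ p) c| <= 1].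
Proof.
move=> A0 ifA; pose B := [set x in A | 1 < #|nbrs A x|].
have [B0 | [x0 x0B]] := set_0Vmem B.
  case/set0Pn: A0 => p pA; have /card_gt0P[c] := ifA p pA.
  rewrite inE => /andP[cA pc].
  have le1 x : x \in A -> #|nbrs A x| <= 1.
    move=> xA; rewrite leqNgt; apply/negP=> gt1.
    by have := in_set0 x; rewrite -B0 !inE xA gt1.
  exists p, c; split=> // [|_]; first exact: le1.
  by apply: leq_trans (le1 c cA); apply/nbrsS/subD1set.
have [|c] := @forest_low_degree B; first by apply/set0Pn; exists x0.
rewrite inE => /andP[cA c_gt1] c_le1.
have [/existsP[p /and3P[pA pc p_le1]] | none] :=
  boolP [exists p, [&& p \in A, edge p c & #|nbrs A p| <= 1]]; last first.
  suff : #|nbrs A c| <= #|nbrs B c| by lia.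
  apply: subset_leq_card; apply/subsetP=> y; rewrite !inE => /andP[yA cy].
  rewrite yA cy ltnNge andbT /=; apply: contraNN none => y_le1.
  by apply/existsP; exists y; rewrite yA edge_sym cy.
exists p, c; split=> // noleaf; apply: leq_trans c_le1.
apply: subset_leq_card; apply/subsetP=> y.
rewrite !inE => /andP[/andP[yp yA] cy].
by rewrite yA cy noleaf // edge_sym.
Qed.

(** In the second alternative, a vertex isolated by the deletion of p and c would
    be a second leaf hanging from c. *)
Lemma forest_leaf A : A != set0 -> isolate_free_on A ->
  exists p c, [/\ p \in A, c \in A, edge p c, #|nbrs A p| <= 1 &
    (exists q, [/\ q \in A, q != p, edge q c & #|nbrs A q| <= 1])
    \/ #|nbrs (A :\ p) c| <= 1 /\ isolate_free_on (A :\ p :\ c)].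
Proof.
move=> A0 ifA; have [p [c [pA cA pc p_le1 c_le1]]] := forest_penultimate A0 ifA.
exists p, c; split=> //.
have [/existsP[q /and4P[qA qp qc q_le1]] | none] :=
  boolP [exists q, [&& q \in A, q != p, edge q c & #|nbrs A q| <= 1]].
  by left; exists q.
have noleaf : {in A, forall q, q != p -> edge q c -> 1 < #|nbrs A q|}.
  move=> q qA qp qc; rewrite ltnNge; apply: contraNN none => q_le1.
  by apply/existsP; exists q; rewrite qA qp qc.
right; split=> [|x /setD1P[xc /setD1P[xp xA]]]; first exact: c_le1.
rewrite lt0n; apply/negP=> /eqP/cards0_eq iso_x.
have only_c y : y \in A -> edge x y -> y = c.
  move=> yA xy; have /setP/(_ y) := iso_x; rewrite !inE yA xy !andbT.
  case: (eqVneq y c) => //= _ /negbFE/eqP yp; case/eqP: xc.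
  by move/nbrsP: p_le1; apply; rewrite // -yp edge_sym.
have /card_gt0P[y] := ifA x xA; rewrite inE => /andP[yA xy].
have := noleaf x xA xp; rewrite -{1}(only_c y yA xy) ltnNge => /(_ xy)/negP; case.
by apply/nbrsP=> z t zA tA xz xt; rewrite (only_c z) // (only_c t).
Qed.

(** * The lower bound for isolate-free forests *)

Lemma mis_dominated_reach A k u v :
  u \in A -> v \in A -> u != v -> reach A k u v ->
  {in A, forall w, w != u -> reach A k u w -> reach A k v w} ->
  #|MIS (reach A k) (A :\ v)| < #|MIS (reach A k) A|.
Proof.
(* [reach A k] is symmetric only on A, so it is first cut down to A. *)
pose r x y := [&& x \in A, y \in A & reach A k x y].
have r_sym : symmetric r.
  move=> x y; rewrite /r andbCA; do 2![case: (boolP (_ \in A)) => //= ?].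
  exact: reach_sym.
have rE : {in A &, reach A k =2 r} by move=> x y xA yA; rewrite /r xA yA.
move=> uA vA uv ruv dom.
rewrite (eq_in_mis rE) (@eq_in_mis _ _ r (A :\ v)); last first.
  by move=> x y /setD1P[_ xA] /setD1P[_ yA]; apply: rE.
apply: (mis_dominated r_sym uA vA uv); first by rewrite /r uA vA.
by move=> w wA wu; rewrite /r uA vA wA /=; apply: dom.
Qed.

(** Each round of the induction deletes one or two vertices and at least one
    maximal independent set; the empty forest has one such set. *)
Lemma forest_mis_bound A k : 1 < k -> isolate_free_on A ->
  #|A| + 2 <= 2 * #|MIS (reach A k) A|.
Proof.
move=> k_gt1; move: {2}#|A| (leqnn #|A|) => n.
elim: n A => [|n IH] A le_n ifA.
  by have := mis_gt0 (reach A k) A; lia.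
have [-> | A0] := eqVneq A set0.
  by have := mis_gt0 (reach set0 k) (set0 : {set G}); rewrite cards0; lia.
have [p [c [pA cA pc p_le1 tail]]] := forest_leaf A0 ifA.
have pNc : p != c by apply: contraTneq pc => ->; rewrite edge_irrefl.
have via x w : edge x c -> #|nbrs A x| <= 1 -> w != x -> reach A k x w ->
    reach A k.-1 c w.
  move=> xc /nbrsP le1 wx xw; rewrite eq_sym in wx.
  have [m [z [-> zA xz zw]]] := reach_first xw wx.
  by rewrite -(le1 z c).
have kE : k = k.-1.+1 by lia.
have cardA := cardsD1 p A; rewrite pA in cardA.
case: tail => [[q [qA qp qc q_le1]] | [c_le1 if_rest]].
  (* The leaves p and q are twins, at distance 2 <= k of one another. *)
  have lt_mis : #|MIS (reach A k) (A :\ p)| < #|MIS (reach A k) A|.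
    apply: (@mis_dominated_reach A k q p) => // [|w wA wq qw].
      apply: (@reach_leq _ 2) => //; apply: (reachS cA qc).
      by apply: (reachS pA); rewrite ?(edge_sym c) //=.
    by rewrite kE; apply: (reachS cA pc); apply: via wq qw.
  rewrite -(eq_in_mis (reach_delete k p_le1)) in lt_mis.
  have : #|A :\ p| + 2 <= 2 * #|MIS (reach (A :\ p) k) (A :\ p)|; last by lia.
  apply: IH; first lia.
  move=> x /setD1P[xp xA]; have /card_gt0P[y] := ifA x xA.
  rewrite inE => /andP[yA xy]; apply/card_gt0P.
  have [yp | yp] := eqVneq y p; last by exists y; rewrite !inE yp yA.
  have xc : x = c by move/nbrsP: p_le1; apply; rewrite // -yp edge_sym.
  by exists q; rewrite xc !inE qp qA edge_sym qc.
have cAp : c \in A :\ p by rewrite !inE eq_sym pNc.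
(* Every walk leaving p passes through c, so the ball around c contains p's. *)
have lt_mis : #|MIS (reach A k) (A :\ c)| < #|MIS (reach A k) A|.
  apply: (@mis_dominated_reach A k p c) => // [|w wA wp pw].
    by apply: (@reach_leq _ 1); [lia | apply: (reachS cA pc) => /=].
  by apply: (@reach_leq _ k.-1); [lia | apply: via wp pw].
have := cardsD1 c (A :\ p); rewrite cAp => cardAp.
have sub : A :\ p :\ c \subset A :\ c by rewrite setSD ?subD1set.
have le_mis := leq_mis (reach A k) sub.
(* Distances survive when p is deleted before c, which then has degree <= 1. *)
have eq_mis : MIS (reach (A :\ p :\ c) k) (A :\ p :\ c)
    = MIS (reach A k) (A :\ p :\ c).
  rewrite (eq_in_mis (reach_delete k c_le1)); apply: eq_in_mis.
  by move=> x y /setD1P[_ ?] /setD1P[_ ?]; apply: reach_delete.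
rewrite -eq_mis in le_mis.
have : #|A :\ p :\ c| + 2 <= 2 * #|MIS (reach (A :\ p :\ c) k) (A :\ p :\ c)|.
  by apply: IH; first lia.
lia.
Qed.

End Reach.

(** * Unions of components *)

Section Components.

Variables (G : sgraph) (k : nat).
Implicit Types (A B C : {set G}).
Local Notation r := (reach [set: G] k).

Lemma closedD A B :
  closed (@edge G) A -> closed (@edge G) B -> closed (@edge G) (A :\: B).
Proof. by move=> clA clB x y xy; rewrite !inE (clA x y) // (clB x y). Qed.

Lemma closed_reach C : closed (@edge G) C ->
  {in C &, reach C k =2 r}.
Proof.
move=> clC x y xC yC; apply/idP/idP; first exact/reachW/subsetT.
by case/(reach_closed clC xC)/andP.
Qed.

Lemma mis_closed_split A C : closed (@edge G) C -> C \subset A ->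
  #|MIS r A| = #|MIS r C| * #|MIS r (A :\: C)|.
Proof.
move=> clC sCA; rewrite -mis_union.
- by rewrite -[X in _ = #|MIS r (X :|: _)|](setIidPr sCA) setID.
- exact: reach_setT_sym.
- by rewrite -setI_eq0 setIDA [C :&: A]setIC -setIDA setDv setI0.
by move=> x y xC /setDP[_]; apply: contra => /(reach_closed clC xC)/andP[].
Qed.

Definition component (x : G) : {set G} := [set y | connect (@edge G) x y].

Lemma component_closed x : closed (@edge G) (component x).
Proof.
apply: intro_closed => [|y z yz]; first exact/sym_connect_sym/edge_sym.
by rewrite !inE => /connect_trans; apply; apply: connect1.
Qed.

Lemma component_clique x : #|component x| <= k.+1 ->
  {in component x &, forall y z, r y z}.
Proof.
move=> le_k y z; rewrite !inE => xy xz.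
have yz : connect (@edge G) y z.
  by rewrite (connect_trans _ xz) // (sym_connect_sym (@edge_sym G)).
have [p yp -> ] := connectP yz; case/shortenP: yp => q yq uq _.
apply: reach_leq (reach_path yq).
suff: #|y :: q| <= #|component x| by rewrite (card_uniqP uq) /=; lia.
apply: subset_leq_card; apply/subsetP=> t tq; rewrite inE.
by apply: connect_trans xy _; apply: path_connect tq.
Qed.

Lemma closed_component A x : closed (@edge G) A -> x \in A -> component x \subset A.
Proof.
move=> clA xA; apply/subsetP=> y; rewrite inE.
by move/(closed_connect clA) => <-.
Qed.

Hypothesis ifG : isolate_free G.

Lemma closed_card_gt1 A : closed (@edge G) A -> A != set0 -> 1 < #|A|.
Proof.
move=> clA /set0Pn[x xA]; have := forallP ifG x.
rewrite -lt0n => /card_gt0P[y]; rewrite inE => xy.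
by apply/card_gt1P; exists x, y; rewrite -(clA x y) // (contraTneq _ xy) // => ->;
  rewrite edge_irrefl.
Qed.

(** The two ends of an edge lie in different maximal independent sets. *)
Lemma mis_edge A : 0 < k -> closed (@edge G) A -> A != set0 -> 1 < #|MIS r A|.
Proof.
move=> k0 clA /set0Pn[x xA]; have := forallP ifG x.
rewrite -lt0n => /card_gt0P[y]; rewrite inE => xy.
have yA : y \in A by rewrite -(clA x y).
have xNy : x != y by apply: contraTneq xy => ->; rewrite edge_irrefl.
have cl : {in [set x; y] &, forall z t, r z t}.
  have rxy : r x y by apply: (@reach_leq _ _ 1) => //; apply: (reachS _ xy) => /=.
  have refl z : r z z by apply: (@reach_leq _ _ 0) => /=.
  by move=> z t /set2P[]-> /set2P[]-> //; rewrite reach_setT_sym.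
have := mis_clique _ cl; rewrite cards2 xNy => <-.
  by apply: leq_mis; rewrite subUset !sub1set xA.
by apply/set0Pn; exists x; rewrite !inE eqxx.
Qed.

(** Components have order at least 2, so the product of their orders is at least
    the sum. *)
Lemma mis_small A : closed (@edge G) A -> A != set0 -> #|A| <= k.+1 ->
  #|A| <= #|MIS r A|.
Proof.
move: {2}#|A| (leqnn #|A|) => n; elim: n A => [|n IH] A le_n clA A0 le_k.
  by move: le_n; rewrite leqn0 cards_eq0 (negPf A0).
have [x xA] := set0Pn _ A0.
have sCA := closed_component clA xA; have clC := component_closed x.
have C0 : component x != set0 by apply/set0Pn; exists x; rewrite inE.
have misC : #|MIS r (component x)| = #|component x|.
  by rewrite mis_clique //; apply/component_clique/(leq_trans (subset_leq_card sCA)).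
rewrite (mis_closed_split clC sCA) misC.
have C2 := closed_card_gt1 clC C0.
have := cardsID (component x) A; rewrite (setIidPr sCA) => cA.
have [D0 | D0] := eqVneq (A :\: component x) set0.
  by rewrite -cA D0 cards0 addn0 leq_pmulr ?mis_gt0.
have clD := closedD clA clC.
have D2 := closed_card_gt1 clD D0.
have := IH _ _ clD D0 _; move=> /(_ ltac:(lia) ltac:(lia)).
nia.
Qed.

Lemma closed_isolate_free A : closed (@edge G) A -> isolate_free_on A.
Proof.
move=> clA x xA; have := forallP ifG x; rewrite -lt0n => /card_gt0P[y].
by rewrite inE => xy; apply/card_gt0P; exists y; rewrite inE -(clA x y) // xA.
Qed.

Lemma mis_closed_bound A : forest G -> 1 < k -> closed (@edge G) A ->
  #|A| + 2 <= 2 * #|MIS r A|.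
Proof.
move=> fG k1 clA; rewrite -(eq_in_mis (closed_reach clA)).
by apply: forest_mis_bound => //; apply: closed_isolate_free.
Qed.

End Components.

(** * Disconnected forests and the graph 2P_2 *)

Lemma f_1 n : 1 < n -> f 1 n <= 2.
Proof.
by move=> n_gt1; rewrite /f -[1 %% 2]/1 -[1 %/ 2]/0 add0n divn1; case: ifP; lia.
Qed.

Lemma f_large k n : k + 1 < n -> f k n < n.
Proof.
move=> lt_kn; rewrite /f ifN -?ltnNge //.
(* k - k %% 2 is twice k %/ 2, so n >= k + 2 makes the quotient at least 2. *)
suff : 2 <= (n - k %% 2) %/ (k %/ 2 + 1) by lia.
by rewrite leq_divRL; lia.
Qed.

Lemma num_MDIS_disconnected_forest k (G : sgraph) :
  0 < k -> 4 < #|G| -> forest G -> isolate_free G -> ~~ connected G ->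
  f k #|G| < num_MDIS G k.
Proof.
move=> k0 n5 fG ifG; rewrite negb_forall => /existsP[x].
rewrite negb_forall => /existsP[y nxy]; rewrite num_MDIS_mis.
have clC := component_closed x; set C := component x in clC.
have clT : closed (@edge G) [set: G] by move=> ? ? _; rewrite !inE.
have clD : closed (@edge G) ([set: G] :\: C) by apply: closedD.
have C0 : C != set0 by apply/set0Pn; exists x; rewrite inE.
have D0 : [set: G] :\: C != set0 by apply/set0Pn; exists y; rewrite !inE nxy.
have C2 := closed_card_gt1 ifG clC C0; have D2 := closed_card_gt1 ifG clD D0.
have := cardsID C [set: G]; rewrite setTI cardsT => cG.
rewrite (mis_closed_split k clC (subsetT C)).
set D := _ :\: C in clD D0 D2 cG *.
case: k k0 => [|[|k]] // _.
  have := @f_1 #|G| ltac:(lia).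
  have := mis_edge ifG (ltn0Sn 0) clC C0; have := mis_edge ifG (ltn0Sn 0) clD D0.
  nia.
have [le_n | lt_n] := leqP #|G| (k.+2 + 1).
  have Cs := @mis_small G k.+2 ifG _ clC C0 ltac:(lia).
  have Ds := @mis_small G k.+2 ifG _ clD D0 ltac:(lia).
  rewrite /f le_n; nia.
have := f_large lt_n.
have Cb := @mis_closed_bound G k.+2 ifG _ fG isT clC.
have Db := @mis_closed_bound G k.+2 ifG _ fG isT clD.
nia.
Qed.

Lemma num_MDIS_2P2 k : 0 < k ->
  num_MDIS (disjoint_union (path_graph 2) (path_graph 2)) k = 4.
Proof.
move=> k0; set G := disjoint_union _ _.
pose C : {set G} := [set inl i | i in 'I_2].
have CE (u : G) : (u \in C) = if u is inl _ then true else false.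
  by case: u => i; apply/imsetP; [exists i | case].
have clC : closed (@edge G) C by case=> i [] j //=; rewrite !CE.
have cardC : #|C| = 2 by rewrite card_imset ?card_ord // => ? ? [].
have cardD : #|[set: G] :\: C| = 2.
  have := cardsID C [set: G]; rewrite setTI cardsT card_sum !card_ord; lia.
have near (u v : G) : (u == v) || edge u v -> reach setT k u v.
  case/orP=> [/eqP-> | uv]; first by apply: (@reach_leq _ _ 0) => /=.
  by apply: (@reach_leq _ _ 1) => //; apply: (reachS _ uv) => /=.
rewrite num_MDIS_mis (mis_closed_split k clC (subsetT C)).
rewrite !mis_clique -?card_gt0 ?cardC ?cardD //.
  move=> u v; rewrite !inE !CE; case: u => i; case: v => j // _ _; apply: near.
  by case: i j => [[|[|//]] ?] [[|[|//]] ?].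
move=> u v; rewrite !CE; case: u => i; case: v => j // _ _; apply: near.
by case: i j => [[|[|//]] ?] [[|[|//]] ?].
Qed.

Theorem corollary3 :
  (forall (k n : nat) (G : sgraph),
      1 <= k -> 5 <= n -> #|G| = n ->
      forest G -> isolate_free G -> ~~ connected G ->
      num_MDIS G k > f k n)
  /\ num_MDIS (disjoint_union (path_graph 2) (path_graph 2)) 2 = f 2 4 + 1
  /\ (forall k : nat, 3 <= k ->
      num_MDIS (disjoint_union (path_graph 2) (path_graph 2)) k = f k 4).
Proof.
split=> [k n G k0 n5 cardG|]; last split=> [|k k3].
- by rewrite -cardG in n5 *; apply: num_MDIS_disconnected_forest.
- by rewrite num_MDIS_2P2.
- by rewrite num_MDIS_2P2 ?(ltn_trans _ k3) // /f addn1 ltnS k3.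
Qed.
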